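(* Let $U\subseteq\mathbb Z$ be infinite, $C\in\mathbb R$ and $d\in\mathbb N$. Suppose $f\in LIP(U)$ satisfies $|f(x)|\le C|x|^d$ for infinitely many $x\in U$. Then there is a polynomial $p\in\mathbb Z[x]$ with $f(x)=p(x)$ for all $x\in U$.
   Context: For an infinite $U\subseteq\mathbb Z$, a function $f\colon U\to\mathbb Z$ is LIP on $U$ if for every finite $X\subseteq U$ there is $p\in\mathbb Z[x]$ with $p(x)=f(x)$ for all $x\in X$; $LIP(U)$ is the ring of all such functions. *)

(* Defs.v *)
From mathcomp Require Import all_boot all_order all_algebra.
From mathcomp Require Import mathcomp_extra boolp classical_sets functions cardinality reals.

Set Implicit Arguments.
Unset Strict Implicit.
Unset Printing Implicit Defensive.

Import Order.TTheory GRing.Theory Num.Theory.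

Local Open Scope classical_set_scope.
Local Open Scope ring_scope.

(* A set [U : set int] used as a type is the subtype of its elements, so
   [U -> int] is the type of functions defined on [U] only, and [val x] is
   [x : U] regarded as an integer. *)
Definition LIP (U : set int) : set (U -> int) :=
  [set f | forall X : set U, finite_set X ->
     exists p : {poly int}, forall x : U, X x -> p.[val x] = f x].

Arguments LIP U : clear implicits.

Lemma LIP_subring (U : set int) : subring_closed [pred f : U -> int | f \in LIP U].
Proof.
split.
- by rewrite !inE => X _; exists 1 => x _; rewrite hornerC.
- move=> f g; rewrite !inE => hf hg X fX.
  have [p hp] := hf X fX; have [q hq] := hg X fX.
  by exists (p - q) => x Xx; rewrite hornerD hornerN hp ?hq.
- move=> f g; rewrite !inE => hf hg X fX.
  have [p hp] := hf X fX; have [q hq] := hg X fX.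
  by exists (p * q) => x Xx; rewrite hornerM hp ?hq.
Qed.

(* Main.v *)
(* Let p have degree at most d and agree with f at d + 1 points u_i of U. Every
   integer polynomial agreeing with f at the u_i and at x differs from p by a
   multiple of Q = prod (X - u_i), so Q(x) divides f(x) - p(x). As Q has degree
   d + 1, the growth bound forces f(x) = p(x) for every large x satisfying it.
   For arbitrary y in U, f(y) - p(y) is then divisible by y - x for infinitely
   many x, hence vanishes. *)
Require Import Defs.
From mathcomp Require Import all_boot all_order all_algebra.
From mathcomp Require Import mathcomp_extra boolp classical_sets functions cardinality reals.
From mathcomp Require Import zify ring.

Import Order.TTheory GRing.Theory Num.Theory.

Local Open Scope classical_set_scope.
Local Open Scope ring_scope.

(** Split off one factor ['X - a%:P] at a time: the other roots differ from [a], so in an integral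
    domain they are roots of the quotient. *)
Lemma roots_prod_XsubC (D : idomainType) (p : {poly D}) (s : seq D) :
  uniq s -> all (root p) s ->
  exists q : {poly D}, p = q * \prod_(a <- s) ('X - a%:P).
Proof.
elim: s p => [|a s IHs] p /=; first by exists p; rewrite big_nil mulr1.
move=> /andP[a_s s_uniq] /andP[/factor_theorem[q ->] /allP s_root].
have [|r qE] := IHs q s_uniq; last by exists r; rewrite big_cons qE mulrAC mulrA.
apply/allP => b b_s; have := s_root b b_s.
rewrite rootM root_XsubC => /orP[//|/eqP b_a].
by rewrite -b_a b_s in a_s.
Qed.

Lemma infinite_set_uniq_seq (T : choiceType) (A : set T) (n : nat) :
  infinite_set A -> exists s : seq T, [/\ uniq s, size s = n & [set` s] `<=` A].
Proof.
move=> A_inf; elim: n => [|n [s [s_uniq s_size sA]]]; first by exists [::].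
have [x [Ax /negP x_s]] : A `\` [set` s] !=set0.
  exact/infinite_setN0/infinite_setD/finite_seq.
exists (x :: s); split => /=; [by rewrite x_s | by rewrite s_size |].
by move=> y /=; rewrite inE => /orP[/eqP->//|/sA].
Qed.

Lemma finite_int_ball (N : nat) : finite_set [set z : int | `|z| <= N%:Z].
Proof.
apply: (@sub_finite_set _ _ [set` [seq k%:Z - N%:Z | k <- iota 0 (N + N + 1)]]).
  move=> z /= zN; apply/mapP; exists (absz (z + N%:Z)); last by lia.
  by rewrite mem_iota; lia.
exact: finite_seq.
Qed.

Lemma infinite_set_unbounded (U : set int) (A : set U) (N : int) :
  infinite_set A -> exists2 x : U, A x & N < `|val x|.
Proof.
move=> A_inf; apply: contrapT => A_bnd; apply: A_inf.
(* The radius is the absolute value of [N] because [N] may be negative. *)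
apply: (@sub_finite_set _ _ (val @^-1` [set z : int | `|z| <= `|N|%N%:Z])).
  move=> x Ax /=; rewrite leNgt; apply/negP => Nx; apply: A_bnd.
  by exists x => //; apply: le_lt_trans Nx; rewrite abszE ler_norm.
by apply: finite_preimage; [move=> x y _ _ /val_inj | exact: finite_int_ball].
Qed.

Lemma horner_norm_le (D : numDomainType) (p : {poly D}) (d : nat) (x : D) :
  (size p <= d.+1)%N -> 1 <= `|x| ->
  `|p.[x]| <= (\sum_(i < d.+1) `|p`_i|) * `|x| ^+ d.
Proof.
move=> p_size x_ge1; rewrite (horner_coef_wide _ p_size) mulr_suml.
apply: le_trans (ler_norm_sum _ _ _) _; apply: ler_sum => i _.
by rewrite normrM normrX ler_wpM2l // ler_weXn2l // -ltnS.
Qed.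

(** Each factor loses at most half: [|u| <= B <= |x| / 2] gives [|x| <= 2 * |x - u|]. *)
Lemma norm_horner_prod_XsubC_ge (D : numDomainType) (s : seq D) (B x : D) :
  {in s, forall u, `|u| <= B} -> 2 * B <= `|x| ->
  `|x| ^+ size s <= 2 ^+ size s * `|(\prod_(u <- s) ('X - u%:P)).[x]|.
Proof.
move=> sB xB; elim: s sB => [|u s IHs] sB /=.
  by rewrite big_nil hornerC normr1 !expr0 mulr1.
rewrite big_cons hornerM hornerXsubC normrM !exprS mulrACA.
apply: ler_pM; rewrite ?exprn_ge0 //; last first.
  by apply: IHs => v v_s; apply: sB; rewrite inE v_s orbT.
have uB : `|u| <= B by apply: sB; rewrite mem_head.
have xu : `|x| - `|u| <= `|x - u| by exact: lerB_dist.
rewrite -subr_ge0.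
have -> : 2 * `|x - u| - `|x| =
  2 * (`|x - u| - (`|x| - `|u|)) + 2 * (B - `|u|) + (`|x| - 2 * B) by ring.
apply: addr_ge0; last by rewrite subr_ge0.
by rewrite addr_ge0 ?mulr_ge0 ?subr_ge0.
Qed.

Section LIPTheory.
Variables (U : set int) (f : U -> int).
Hypothesis f_LIP : f \in LIP U.

Lemma LIP_seq (s : seq U) :
  exists p : {poly int}, {in s, forall x, p.[val x] = f x}.
Proof.
have /set_mem/(_ [set` s] (finite_seq s))[p hp] := f_LIP.
by exists p => x /hp.
Qed.

(** An interpolant of any degree can be reduced modulo the product of the ['X - u%:P]: this product
    is monic, so division stays over the integers, and the remainder keeps the values at the
    nodes. *)
Lemma LIP_interpolation (s : seq U) :
  exists2 p : {poly int}, (size p <= size s)%N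
    & {in s, forall x, p.[val x] = f x}.
Proof.
have [q hq] := LIP_seq s.
pose Q : {poly int} := \prod_(u <- map val s) ('X - u%:P).
have Q_monic : Q \is monic by exact: monic_prod_XsubC.
exists (Pdiv.Ring.rmodp q Q).
  have := Pdiv.Ring.ltn_rmodp q Q.
  by rewrite monic_neq0 // size_prod_XsubC size_map ltnS.
move=> x x_s; rewrite -hq // [in RHS](Pdiv.RingMonic.rdivp_eq Q_monic q).
rewrite hornerD hornerM; have /rootP -> : root Q (val x).
  by rewrite root_prod_XsubC map_f.
by rewrite mulr0 add0r.
Qed.

Lemma LIP_sub_dvd (s : seq U) (p : {poly int}) (x : U) :
  uniq s -> {in s, forall u, p.[val u] = f u} ->
  exists k : int,
    f x - p.[val x] = k * (\prod_(u <- map val s) ('X - u%:P)).[val x].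
Proof.
move=> s_uniq hp; have [q hq] := LIP_seq (x :: s).
have [||r rE] := @roots_prod_XsubC _ (q - p) (map val s).
- by rewrite map_inj_uniq //; exact: val_inj.
- apply/allP => _ /mapP[u u_s ->]; apply/rootP.
  by rewrite hornerD hornerN hq ?hp ?subrr // inE u_s orbT.
exists r.[val x]; rewrite -hornerM -rE hornerD hornerN hq //.
exact: mem_head.
Qed.

Lemma LIP_eq_horner (p : {poly int}) :
  (forall N : int, exists2 v : U, f v = p.[val v] & N < `|val v|) ->
  forall y : U, f y = p.[val y].
Proof.
(* With this bound, [f y - p.[val y] = k * (val y - val v)] and [k != 0] would give [|v| <= |y| + |y
   - v| <= |y| + |f y - p.[val y]| < |v|]. *)
move=> hp y; have [v fv v_big] := hp (`|val y| + `|f y - p.[val y]|).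
have [||k] := @LIP_sub_dvd [:: v] p y; first by [].
  by move=> u; rewrite inE => /eqP->.
rewrite big_map big_seq1 hornerXsubC => E.
have [k0|k_neq0] := eqVneq k 0; first by rewrite k0 mul0r in E; lia.
have k_ge1 : 1 <= `|k| by lia.
have /(lt_le_trans v_big) : `|val v| <= `|val y| + `|val y - val v|.
  by rewrite -{1}(subKr (val y) (val v)) ler_normB.
by rewrite ltrD2l E normrM ltNge ler_peMl.
Qed.

Lemma LIP_growth_horner (C : int) (d : nat) :
  infinite_set [set: U] ->
  exists (p : {poly int}) (N : int), forall x : U,
    N < `|val x| -> `|f x| <= C * `|val x| ^+ d -> f x = p.[val x].
Proof.
move=> U_inf.
have [s [s_uniq s_size _]] := infinite_set_uniq_seq _ _ d.+1 U_inf.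
have [p p_size hp] := LIP_interpolation s.
pose B : int := \sum_(u <- map val s) `|u|.
pose K : int := `|C| + \sum_(i < d.+1) `|p`_i|.
(* The term [2 * B] allows the lower bound on the product [q]. If [k != 0], then [|x| ^+ d.+1 <= 2
   ^+ d.+1 * |q| <= 2 ^+ d.+1 * K * |x| ^+ d], which the second term excludes. *)
exists p, (2 * B + 2 ^+ d.+1 * K) => x x_big fx.
have B_ge0 : 0 <= B by exact: sumr_ge0.
have K_ge0 : 0 <= K by rewrite addr_ge0 ?sumr_ge0.
have tK_ge0 : 0 <= 2 ^+ d.+1 * K by rewrite mulr_ge0 ?exprn_ge0.
have x_ge1 : 1 <= `|val x| by lia.
have fpK : `|f x - p.[val x]| <= K * `|val x| ^+ d.
  apply: le_trans (ler_normB _ _) _; rewrite mulrDl lerD //.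
    by apply: le_trans fx _; rewrite ler_wpM2r ?exprn_ge0 ?ler_norm.
  by apply: horner_norm_le; rewrite // -s_size.
have sB : {in map val s, forall u, `|u| <= B}.
  by move=> u u_s; rewrite /B (big_rem u) //= lerDl sumr_ge0.
have xB : 2 * B <= `|val x| by lia.
have := norm_horner_prod_XsubC_ge _ _ _ _ sB xB.
have [k kE] := LIP_sub_dvd s p x s_uniq hp.
rewrite size_map s_size; set q := (\prod_(_ <- _) _).[_] in kE * => xq.
have [k0|k_neq0] := eqVneq k 0; first by rewrite k0 mul0r in kE; lia.
have k_ge1 : 1 <= `|k| by lia.
have qK : `|q| <= K * `|val x| ^+ d.
  by apply: le_trans fpK; rewrite kE normrM ler_peMl.
have : `|val x| * `|val x| ^+ d <= 2 ^+ d.+1 * K * `|val x| ^+ d.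
  by rewrite -exprS -mulrA (le_trans xq) // ler_wpM2l ?exprn_ge0.
rewrite ler_pM2r ?exprn_gt0 //; lia.
Qed.

End LIPTheory.

Theorem theorem3 (R : realType) (U : set int) (C : R) (d : nat) (f : U -> int)
    (U_infinite : infinite_set U)
    (f_LIP : f \in LIP U)
    (f_growth : infinite_set
       [set x : U | `|f x|%:~R <= C * `|val x|%:~R ^+ d]) :
  exists p : {poly int}, forall x : U, f x = p.[val x].
Proof.
have UT_inf : infinite_set [set: U] by apply: sub_infinite_set f_growth.
(* Rounding [C] up keeps the growth bound and moves it to the integers. *)
have [p [N hp]] := LIP_growth_horner U f f_LIP (Num.ceil C) d UT_inf.
exists p; apply: LIP_eq_horner => // M.
(* Choosing [v] in the growth set, beyond both [M] and [N], makes [hp] applicable to it. *)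
have [v fv v_big] := infinite_set_unbounded _ _ (`|M| + `|N|) f_growth.
exists v; last by lia.
apply: hp; first by lia.
rewrite -(ler_int R) rmorphM rmorphXn /=; apply: le_trans fv _.
by rewrite ler_wpM2r ?exprn_ge0 ?ler0z // ceil_ge.
Qed.
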